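(* Let $\mathcal{A}$ and $\mathcal{B}$ be unital $*$-subalgebras of $M_n$. Then $\mathcal{A}$ and $\mathcal{B}$ are quasiorthogonal if and only if for every maximal commutative $*$-subalgebra $\mathcal{C}$ of $\mathcal{A}$ and every maximal commutative $*$-subalgebra $\mathcal{D}$ of $\mathcal{B}$, the algebras $\mathcal{C}$ and $\mathcal{D}$ are quasiorthogonal.
   Context: $M_n$ is the algebra of $n\times n$ complex matrices. A unital $*$-subalgebra of $M_n$ is a complex subalgebra closed under conjugate transpose and containing $I_n$. A maximal commutative $*$-subalgebra of $\mathcal{A}$ is a commutative $*$-subalgebra of $\mathcal{A}$ not properly contained in any other commutative $*$-subalgebra of $\mathcal{A}$. Unital $*$-subalgebras $\mathcal{A},\mathcal{B}\subseteq M_n$ are quasiorthogonal if $\mathrm{Tr}(AB)=\frac{\mathrm{Tr}(A)\mathrm{Tr}(B)}{n}$ for all $A\in\mathcal{A}$, $B\in\mathcal{B}$. *)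

(* Defs.v *)
From mathcomp Require Import all_boot all_order all_algebra.
From mathcomp Require Import spectral.
From mathcomp Require Import reals complex.

Set Implicit Arguments.
Unset Strict Implicit.
Unset Printing Implicit Defensive.

Import GRing.Theory.

Local Open Scope ring_scope.
Local Open Scope sesquilinear_scope.
Local Open Scope complex_scope.

Section StarSubalgebras.
Variables (R : realType) (n : nat).
Implicit Types A B C D : {vspace 'M[R[i]]_n}.

(* Not necessarily unital: unitality is [1%:M \in A]. *)
Definition star_subalgebra A : Prop :=
  {in A &, forall X Y, X *m Y \in A} /\ {in A, forall X, X^t* \in A}.

Definition unital_star_subalgebra A : Prop :=
  star_subalgebra A /\ 1%:M \in A.

Definition commutative_star_subalgebra A : Prop :=
  star_subalgebra A /\ {in A &, forall X Y, comm_mx X Y}.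

Definition maximal_commutative_star_subalgebra A C : Prop :=
  [/\ commutative_star_subalgebra C,
      (C <= A)%VS
    & forall D, commutative_star_subalgebra D -> (D <= A)%VS ->
        (C <= D)%VS -> D = C].

Definition quasiorthogonal A B : Prop :=
  {in A & B, forall X Y, \tr (X *m Y) = \tr X * \tr Y / n%:R}.

(* Hence [quasiorthogonal] is only ever applied to unital algebras when it is
   applied to maximal commutative *-subalgebras of unital *-subalgebras. *)
Lemma maximal_commutative_unital A C :
  unital_star_subalgebra A -> maximal_commutative_star_subalgebra A C ->
  unital_star_subalgebra C.
Proof.
move=> [_ A1] [[[CM CS] Cc] sCA maxC]; split; first by split.
suff <- : (C + <[1%:M]>)%VS = C.
  by rewrite -[X in X \in _]add0r memv_add ?mem0v ?memv_line.
apply: maxC; last exact: addvSl; last first.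
  by rewrite subv_add sCA -memvE.
split; first split.
- move=> _ _ /memv_addP[x Cx [_ /vlineP[a ->] ->]]
             /memv_addP[y Cy [_ /vlineP[b ->] ->]].
  rewrite mulmxDl !mulmxDr -!scalemxAl -!scalemxAr !mul1mx mulmx1 addrA.
  apply: memv_add; last by rewrite !memvZ ?memv_line.
  by rewrite !rpredD ?CM ?memvZ.
- move=> _ /memv_addP[x Cx [_ /vlineP[a ->] ->]].
  rewrite linearD linearZ /= trmx1 map_mxD map_mxZ map_mx1.
  by rewrite memv_add ?CS ?memvZ ?memv_line.
- move=> _ _ /memv_addP[x Cx [_ /vlineP[a ->] ->]]
             /memv_addP[y Cy [_ /vlineP[b ->] ->]].
  by rewrite !scalemx1; apply: comm_mxD; [apply/comm_mx_sym/comm_mxD => //;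
    [exact: Cc | exact: comm_mx_scalar]|exact: comm_mx_scalar].
Qed.

End StarSubalgebras.

(* Main.v *)
(** Quasiorthogonality is a bilinear condition, and every element of a
    *-subalgebra is [H + iK] with [H], [K] hermitian elements of it; so it is
    enough to test pairs of hermitian matrices. The polynomials in a hermitian
    [H] form a commutative *-subalgebra, and by finite dimensionality it lies in
    a maximal one. *)
Require Import Defs.
From mathcomp Require Import all_boot all_order all_algebra.
From mathcomp Require Import reals complex.
From mathcomp Require Import spectral boolp ring.

Set Implicit Arguments.
Unset Strict Implicit.
Unset Printing Implicit Defensive.

Import GRing.Theory Num.Theory.

Local Open Scope ring_scope.
Local Open Scope sesquilinear_scope.
Local Open Scope complex_scope.

Section Adjoint.
Variable C : numClosedFieldType.

Lemma trmxC_D m n (X Y : 'M[C]_(m, n)) : (X + Y)^t* = X^t* + Y^t*.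
Proof. by rewrite linearD map_mxD. Qed.

Lemma trmxC_Z m n (a : C) (X : 'M[C]_(m, n)) : (a *: X)^t* = a^* *: X^t*.
Proof. by rewrite linearZ map_mxZ. Qed.

Lemma trmxC_mul m n p (X : 'M[C]_(m, n)) (Y : 'M[C]_(n, p)) :
  (X *m Y)^t* = Y^t* *m X^t*.
Proof. by rewrite trmx_mul map_mxM. Qed.

(** This gives closure under adjoint for the algebra of polynomials in [H]. Morally [q] is [p] with
    conjugated coefficients; it is built along Horner's scheme instead. *)
Lemma horner_mx_trmxC n (H : 'M[C]_n.+1) (p : {poly C}) :
  H^t* = H -> exists q, (horner_mx H p)^t* = horner_mx H q.
Proof.
move=> hH; elim/poly_ind: p => [|p c [q hq]].
  by exists 0; rewrite !rmorph0 trmx0 map_mx0.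
(* The adjoint reverses products, so [p(H) H + c] becomes [H q(H)] plus the conjugate of [c]; hence
   ['X] stands on the left. *)
exists ('X * q + (c^*)%:P).
rewrite !rmorphD !rmorphM /= !horner_mx_X !horner_mx_C trmxC_D -mulmxE.
by rewrite trmxC_mul hq hH tr_scalar_mx map_scalar_mx.
Qed.

End Adjoint.

Section Star.
Variables (R : realType) (n : nat).
Implicit Types (X Y H K : 'M[R[i]]_n) (A B C D : {vspace 'M[R[i]]_n}).

Lemma hermitian_decomposition A X :
  star_subalgebra A -> X \in A ->
  exists H K, [/\ H \in A, K \in A, H^t* = H, K^t* = K & X = H + 'i%R *: K].
Proof.
move=> [_ AS] AX.
have c2 : (2^-1 : R[i])^*%R = 2^-1 by rewrite fmorphV rmorph_nat.
(* Real and imaginary parts of [X]; the second scalar is [1 / (2i)]. *)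
exists (2^-1 *: (X + X^t*)), ((- 'i%R / 2) *: (X - X^t*)).
split; first by rewrite memvZ ?memvD ?AS.
- by rewrite memvZ ?memvB ?AS.
- by rewrite trmxC_Z trmxC_D trmxCK c2 addrC.
- rewrite -[- X^t*]scaleN1r trmxC_Z trmxC_D trmxC_Z trmxCK.
  rewrite rmorphM !rmorphN rmorph1 /= conjCi c2 opprK !scaleN1r.
  by rewrite mulNr scaleNr -scalerN opprB.
- rewrite scalerA mulrA mulrN mulCii opprK mul1r -scalerDr addrACA subrr addr0.
  by rewrite -mulr2n -[X in _ *: X]scaler_nat scalerA mulVf ?scale1r ?pnatr_eq0.
Qed.

(** Induction on the codimension of [C] in [A]: if [C] is not maximal, classical logic yields a
    strictly larger commutative *-subalgebra, to which the induction hypothesis applies. *)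
Lemma commutative_star_subalgebra_maximal A C :
  commutative_star_subalgebra C -> (C <= A)%VS ->
  exists2 D, maximal_commutative_star_subalgebra A D & (C <= D)%VS.
Proof.
have [k] := ubnP (\dim A - \dim C); elim: k C => // k IHk C ltk cC sCA.
have [maxC | notmax] := pselect (maximal_commutative_star_subalgebra A C).
  by exists C.
have [D [cD sDA sCD neqDC]] : exists D,
    [/\ commutative_star_subalgebra D, (D <= A)%VS, (C <= D)%VS & D <> C].
  apply: contrapT => noD; apply: notmax; split=> // D cD sDA sCD.
  by apply: contrapT => neqDC; apply: noD; exists D.
have ltCD : (\dim C < \dim D)%N.
  rewrite ltn_neqAle dimvS // andbT; apply/negP=> eqdim.
  by apply: neqDC; apply/esym/eqP; rewrite eqEdim sCD (eqP eqdim) /=.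
have [E maxE sDE] : exists2 E, maximal_commutative_star_subalgebra A E
                             & (D <= E)%VS.
  apply: IHk => //; rewrite -ltnS; apply: leq_trans ltk; rewrite ltnS.
  (* Truncated subtraction decreases strictly here because [\dim C < \dim D <= \dim A]. *)
  by rewrite ltn_sub2l // (leq_trans ltCD) ?dimvS.
by exists E => //; apply: subv_trans sDE.
Qed.

End Star.

Lemma hermitian_in_commutative_star_subalgebra (R : realType) n
    (A : {vspace 'M[R[i]]_n}) (H : 'M[R[i]]_n) :
  unital_star_subalgebra A -> H \in A -> H^t* = H ->
  exists C : {vspace 'M[R[i]]_n},
    [/\ commutative_star_subalgebra C, (C <= A)%VS & H \in C].
Proof.
(* [horner_mx] needs a nonzero size, so the trivial size 0 is treated apart. *)
case: n A H => [|n] A H [[AM AS] A1] AH hH.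
  have all0 (X : 'M[R[i]]_0) : X = 0 by apply/matrixP=> -[].
  exists 0%VS; split; [split; [split|]|exact: sub0v|by rewrite (all0 H) mem0v].
  - by move=> X Y _ _; rewrite (all0 (X *m Y)) mem0v.
  - by move=> X _; rewrite (all0 (X^t*)) mem0v.
  - by move=> X Y _ _; rewrite /comm_mx (all0 (X *m Y)) (all0 (Y *m X)).
(* To obtain a [{vspace _}], the polynomials in [H] are taken as the image of a linear map on
   coefficient vectors of bounded length. By [fP] no polynomial is lost: modulo the minimal
   polynomial of [H], each has a representative of that length. *)
pose f := linfun (horner_mx H \o @rVpoly _ (degree_mxminpoly H)).
have fP Y : reflect (exists p, Y = horner_mx H p) (Y \in limg f).
  apply: (iffP idP) => [/memv_imgP[v _ ->] | [p ->]].
    by exists (rVpoly v); rewrite lfunE.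
  have <- := mx_inv_hornerK (horner_mx_mem H p).
  by apply/memv_imgP; eexists; [exact: memvf | rewrite lfunE].
exists (limg f); split; last by apply/fP; exists 'X; rewrite horner_mx_X.
- split; first split.
  + move=> _ _ /fP[p ->] /fP[q ->]; apply/fP; exists (p * q).
    by rewrite rmorphM.
  + by move=> _ /fP[p ->]; apply/fP; apply: horner_mx_trmxC.
  + by move=> _ _ /fP[p ->] /fP[q ->]; apply: comm_horner_mx2.
(* Constant terms stay in [A] because [A] is unital. *)
- apply/subvP=> _ /fP[p ->]; elim/poly_ind: p => [|p c IHp].
    by rewrite rmorph0 mem0v.
  rewrite rmorphD rmorphM /= horner_mx_X horner_mx_C -scalemx1.
  by rewrite memvD ?memvZ //; apply: AM.
Qed.

Theorem proposition4p8 (R : realType) (n : nat) (n_gt0 : (0 < n)%N)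
    (A B : {vspace 'M[R[i]]_n})
    (hA : unital_star_subalgebra A) (hB : unital_star_subalgebra B) :
  quasiorthogonal A B <->
  (forall C D : {vspace 'M[R[i]]_n},
     maximal_commutative_star_subalgebra A C ->
     maximal_commutative_star_subalgebra B D ->
     quasiorthogonal C D).
Proof.
split=> [qAB C D [_ /subvP sCA _] [_ /subvP sDB _] X Y CX DY | qmax].
  by apply: qAB; [apply: sCA | apply: sDB].
have qherm H K : H \in A -> K \in B -> H^t* = H -> K^t* = K ->
    \tr (H *m K) = \tr H * \tr K / n%:R.
  move=> AH BK hH hK.
  have [C0 [cC sCA C0H]] := hermitian_in_commutative_star_subalgebra hA AH hH.
  have [D0 [cD sDB D0K]] := hermitian_in_commutative_star_subalgebra hB BK hK.
  have [C maxC /subvP sC] := commutative_star_subalgebra_maximal cC sCA.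
  have [D maxD /subvP sD] := commutative_star_subalgebra_maximal cD sDB.
  by apply: (qmax C D) => //; [apply: sC | apply: sD].
move=> X Y AX BY.
have [H1 [K1 [AH1 AK1 hH1 hK1 ->]]] := hermitian_decomposition hA.1 AX.
have [H2 [K2 [BH2 BK2 hH2 hK2 ->]]] := hermitian_decomposition hB.1 BY.
(* Both sides are bilinear, with no conjugation, so the identity follows from the four hermitian
   pairs. *)
rewrite mulmxDl !mulmxDr -!scalemxAl -!scalemxAr !mxtraceD !mxtraceZ !qherm //.
by ring.
Qed.
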